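(* $\mathrm{cf}^\ast(\mathrm{Sym}(\omega))\leq \mathfrak b(\mathcal L)$ for every ultrafilter $\mathcal L$ on $\omega$ which is not coherent to a $Q$-point.
   Context: $\mathrm{Sym}(\omega)$ is the group of all permutations of $\omega$. For $x,y\in\omega^\omega$, $x\leq^\ast y$ means $x(n)\leq y(n)$ for all but finitely many $n$. For an increasing function $f\in\omega^\omega$, $S_f$ is the subgroup of $\mathrm{Sym}(\omega)$ generated by $\{\pi\in\mathrm{Sym}(\omega):\pi,\pi^{-1}\leq^\ast f\}$. $\mathrm{cf}^\ast(\mathrm{Sym}(\omega))$ is the minimal length $\lambda$ of an increasing (with respect to inclusion) chain $\langle G_i:i<\lambda\rangle$ of proper subgroups of $\mathrm{Sym}(\omega)$ with $\bigcup_{i<\lambda}G_i=\mathrm{Sym}(\omega)$ such that for every increasing $f\in\omega^\omega$ there is $i<\lambda$ with $S_f\subset G_i$. All filters are assumed non-principal. For an ultrafilter $\mathcal F$ on $\omega$ and $x,y\in\omega^\omega$, $x\leq_{\mathcal F}y$ means $\{n:x(n)\leq y(n)\}\in\mathcal F$; $\mathfrak b(\mathcal F)$ is the cofinality of the linearly (pre)ordered set $(\omega^\omega,\leq_{\mathcal F})$. Ultrafilters $\mathcal F$ and $\mathcal U$ on $\omega$ are coherent if there is an increasing sequence $\langle k_n:n\in\omega\rangle$ of natural numbers such that for every $I\subset\omega$, $\bigcup_{n\in I}[k_n,k_{n+1})\in\mathcal F$ if and only if $\bigcup_{n\in I}[k_n,k_{n+1})\in\mathcal U$. An ultrafilter $\mathcal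 L$ is a $Q$-point if for every monotone (nondecreasing) surjection $\phi:\omega\to\omega$ there is $L\in\mathcal L$ such that $\phi\restriction L$ is injective. *)

(* Defs.v *)
From HB Require Import structures.
From mathcomp Require Import wochoice all_boot all_classical.

Set Implicit Arguments.
Unset Strict Implicit.
Unset Printing Implicit Defensive.

Local Open Scope classical_set_scope.

(* An ordinal is represented by a well-ordered type of that order type, [wo_rel]
   being the large (reflexive) order.  A cardinal is an initial ordinal, so that
   lengths of chains and cardinalities are both compared by [wo_le]. *)
Record woType := WoType {
  wo_sort :> Type;
  wo_rel : rel wo_sort;
  wo_relP : well_order wo_rel
}.

Arguments wo_rel {w} i j : rename.

Definition wo_le (a b : woType) :=
  exists2 f : a -> b, {mono f : i j / wo_rel i j} &
    forall i j, wo_rel j (f i) -> exists i', f i' = j.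

(* As [wo_le] compares order types, such an [a] is unique up to isomorphism. *)
Definition least_ordinal (P : woType -> Prop) (a : woType) :=
  P a /\ forall b, P b -> wo_le a b.

Record Sym (T : Type) := SymBuild {
  sym_fun :> T -> T;
  sym_inv : T -> T;
  sym_funK : cancel sym_fun sym_inv;
  sym_invK : cancel sym_inv sym_fun
}.

Section SymGroup.
Variable T : Type.
Implicit Types s t u : Sym T.

Lemma sym_eqP s t : s =1 t -> s = t.
Proof.
case: s t => [f f' fK f'K] [g g' gK g'K] /= /funext efg; subst g.
have e : f' = g' by apply/funext => x; rewrite -[x in LHS]g'K fK.
subst g'.
by rewrite (Prop_irrelevance fK gK) (Prop_irrelevance f'K g'K).
Qed.

HB.instance Definition _ := gen_eqMixin (Sym T).
HB.instance Definition _ := gen_choiceMixin (Sym T).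

Definition sym_one : Sym T := @SymBuild T id id (frefl id) (frefl id).

Definition sym_mul s t : Sym T :=
  SymBuild (can_comp (sym_funK s) (sym_funK t))
           (can_comp (sym_invK t) (sym_invK s)).

Definition sym_V s : Sym T := SymBuild (sym_invK s) (sym_funK s).

Lemma sym_mulA : associative sym_mul.
Proof. by move=> s t u; exact: sym_eqP. Qed.

Lemma sym_mul1s : left_id sym_one sym_mul.
Proof. by move=> s; exact: sym_eqP. Qed.

Lemma sym_muls1 : right_id sym_one sym_mul.
Proof. by move=> s; exact: sym_eqP. Qed.

Lemma sym_mulVs : left_inverse sym_one sym_V sym_mul.
Proof. by move=> s; apply: sym_eqP => x /=; rewrite sym_funK. Qed.

Lemma sym_mulsV : right_inverse sym_one sym_V sym_mul.
Proof. by move=> s; apply: sym_eqP => x /=; rewrite sym_invK. Qed.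

HB.instance Definition _ := isGroup.Build (Sym T)
  sym_mulA sym_mul1s sym_muls1 sym_mulVs sym_mulsV.

End SymGroup.

Definition subgroup (G : groupType) (H : set G) : Prop := group_closed [in H].

Definition increasing (f : nat -> nat) := {homo f : m n / m < n}.

Definition le_star (x y : nat -> nat) : Prop := \forall n \near \oo, x n <= y n.

Definition S_ (f : nat -> nat) : set (Sym nat) :=
  smallest (@subgroup (Sym nat)) [set p : Sym nat | le_star p f /\ le_star p^-1%g f].

(* The chain need not be strict: listing each of its members once gives a strict
   chain which is not longer, so the least length is the same. *)
Definition cfstar_chain (lam : woType) (G : lam -> set (Sym nat)) :=
  [/\ forall i, subgroup (G i) /\ G i <> [set: Sym nat],
      forall i j, wo_rel i j -> G i `<=` G j,
      \bigcup_i G i = [set: Sym nat] &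
      forall f, increasing f -> exists i, S_ f `<=` G i].

Definition is_cfstar : woType -> Prop :=
  least_ordinal (fun lam => exists G : lam -> set (Sym nat), cfstar_chain G).

Definition cofinal_in (T : Type) (R : T -> T -> Prop) (D : set T) :=
  forall x, exists2 y, D y & R x y.

(* The least ordinal equipotent to a cofinal set is automatically initial. *)
Definition is_cofinality (T : Type) (R : T -> T -> Prop) : woType -> Prop :=
  least_ordinal (fun kap =>
    exists D : set T, cofinal_in R D /\ (D #= [set: kap])%card).

Definition le_filter (F : set_system nat) (x y : nat -> nat) : Prop :=
  F [set n | x n <= y n].

Definition is_b (F : set_system nat) : woType -> Prop :=
  is_cofinality (le_filter F).

Definition nonprincipal_ultrafilter (F : set_system nat) :=
  UltraFilter F /\ forall n, F <> principal_filter n.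

(* Strict monotonicity of [k] matters: for a constant [k] all unions are empty. *)
Definition coherent (F U : set_system nat) :=
  exists2 k : nat -> nat, increasing k &
    forall I : set nat,
      F (\bigcup_(n in I) [set m | k n <= m < k n.+1]) <->
      U (\bigcup_(n in I) [set m | k n <= m < k n.+1]).

Definition Q_point (F : set_system nat) :=
  nonprincipal_ultrafilter F /\
  forall phi : nat -> nat,
    {homo phi : m n / m <= n} -> set_surj [set: nat] [set: nat] phi ->
    exists2 A, F A & set_inj A phi.

(* Main.v *)
Require Import Defs.
From mathcomp Require Import all_boot all_classical.
From mathcomp Require Import wochoice zify.

Set Implicit Arguments.
Unset Strict Implicit.
Unset Printing Implicit Defensive.

Local Open Scope classical_set_scope.

(** Let [d] enumerate a cofinal set of functions modulo [L] in order type
    [kap], the cofinality.  The [i]-th subgroup of the chain consists of the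
    permutations that, together with their inverse, are eventually bounded by an
    iterate of a nondecreasing function lying below some [d j] with [j <= i],
    modulo [L].  Since the preorder modulo [L] is total, these functions are
    closed under maxima, so that the permutations form a subgroup
    ([dominated_perms_subgroup]); it contains [S_ f] for every such increasing
    [f] ([S_sub_dominated_perms]).  The enumeration being cofinal, the chain
    swallows every [S_ f] and every permutation.

    It remains to see that each subgroup is proper.  By minimality of the
    cofinality an initial segment of [d] is bounded by one function [h] modulo
    [L] ([cofinality_enum]), and it suffices to find a permutation that no
    iterate of a function below [h] modulo [L] dominates
    ([dominated_perms_proper]).  Cut the natural numbers into intervals that grow
    faster than [h].  As [L] is not coherent to a Q-point, these intervals can be
    grouped into longer blocks so that every set of [L] meets some block in two
    different intervals ([not_Q_blocks]).  A nondecreasing function that is at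
    most [h] on a set of [L] needs more and more steps to cross a block: if [C]
    steps always sufficed, then the points of this set in a block would fall into
    boundedly many groups of neighbouring intervals, and the ultrafilter would
    select a set meeting each block in one interval only.  A permutation that
    leaps, itself or by its inverse, from the start of each block past its end is
    therefore not dominated.

    The least length of a chain and the cofinality exist because any two
    well-orders are comparable ([same_rank_total], [least_ordinal_exists]), and
    the inequality is then the minimality of the least length. *)

(** * Well-orders and least ordinals *)

Section WellOrder.
Variable a : woType.
Implicit Types x y z : a.

(** The strict order; as [wo_rel] is total, this is the negation of its
    converse. *)
Definition wo_lt x y := ~~ wo_rel y x.

Lemma wo_least (P : a -> Prop) :
  (exists x, P x) -> exists2 z, P z & forall x, P x -> wo_rel z x.
Proof.
move=> [x Px]; have [|z [[Az zmin] _]] := @wo_relP a (fun x => `[< P x >]).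
  by exists x; apply/asboolP.
by exists z => [|y Py]; [exact/asboolP | apply: zmin; apply/asboolP].
Qed.

Lemma wo_refl x : wo_rel x x.
Proof. by have [|z -> zmin] := @wo_least (eq x); [exists x | exact: zmin]. Qed.

Lemma wo_total x y : wo_rel x y || wo_rel y x.
Proof.
have [|z zxy zmin] := @wo_least (fun z => z = x \/ z = y).
  by exists x; left.
by case: zxy zmin => -> zmin; apply/orP; [left|right]; apply: zmin; [right|left].
Qed.

Lemma wo_anti x y : wo_rel x y -> wo_rel y x -> x = y.
Proof.
move=> xy yx; have [|z [_ zuniq]] := @wo_relP a (fun z => `[< z = x \/ z = y >]).
  by exists x; apply/asboolP; left.
have min_xy u : u = x \/ u = y -> z = u.
  move=> uxy; apply: zuniq; split; first exact/asboolP.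
  by move=> v /asboolP; case: uxy => -> [] -> //; exact: wo_refl.
by rewrite -(min_xy x) ?(min_xy y); auto.
Qed.

Lemma wo_trans x y z : wo_rel x y -> wo_rel y z -> wo_rel x z.
Proof.
move=> xy yz.
have [|u uxyz umin] := @wo_least (fun u => [\/ u = x, u = y | u = z]).
  by exists x; constructor 1.
case: uxyz umin => -> umin.
- by apply: umin; constructor 3.
- by rewrite (wo_anti xy) //; apply: umin; constructor 1.
- by rewrite -(wo_anti yz) //; apply: umin; constructor 2.
Qed.

Lemma wo_ltW x y : wo_lt x y -> wo_rel x y.
Proof.
by rewrite /wo_lt; have := wo_total x y; case: (wo_rel y x); rewrite ?orbF.
Qed.

Lemma wo_lt_trans x y z : wo_lt x y -> wo_lt y z -> wo_lt x z.
Proof.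
by move=> xy yz; apply: contra xy => zx; apply: wo_trans zx; exact: wo_ltW.
Qed.

Lemma wo_ltgtP x y : [\/ x = y, wo_lt x y | wo_lt y x].
Proof.
case yx: (wo_rel y x); last by constructor 2; rewrite /wo_lt yx.
case xy: (wo_rel x y); last by constructor 3; rewrite /wo_lt xy.
by constructor 1; exact: wo_anti.
Qed.

Lemma wo_ind (P : a -> Prop) :
  (forall x, (forall y, wo_lt y x -> P y) -> P x) -> forall x, P x.
Proof.
move=> step x; apply: contrapT => nPx.
have [|z nPz zmin] := @wo_least (fun x => ~ P x); first by exists x.
by apply: nPz; apply: step => y yz; apply: contrapT => /zmin; apply/negP.
Qed.

(** A strictly increasing self-map of a well-order never lies below the
    identity. *)
Lemma wo_incr_ge (f : a -> a) :
  (forall x y, wo_lt x y -> wo_lt (f x) (f y)) -> forall x, wo_rel x (f x).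
Proof.
move=> finc; apply: wo_ind => x IH; apply: contrapT => /negP fx.
by have /negP := finc _ _ fx; apply; exact: IH.
Qed.

Lemma wo_seg_subproof x :
  well_order (fun u v : {y | wo_lt y x} => wo_rel (sval u) (sval v)).
Proof.
move=> A [u Au].
have [|z [zx Az] zmin] :=
    @wo_least (fun y => exists yx : wo_lt y x, exist _ y yx \in A).
  by case: u Au => y yx Au; exists y, yx.
exists (exist _ z zx); split.
  by split=> // -[v vx] Av; apply: zmin; exists vx.
move=> [v vx] [Av vmin].
have e : z = v.
  by apply: wo_anti; [apply: zmin; exists vx | exact: (vmin _ Az)].
by subst v; congr exist; exact: bool_irrelevance.
Qed.

(** The initial segment of the elements below [x], with the induced order. *)
Definition wo_seg x : woType := WoType (@wo_seg_subproof x).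

End WellOrder.

(** A well-order does not embed into a proper initial segment of itself. *)
Lemma wo_le_segF (a : woType) (x : a) : ~ wo_le a (wo_seg x).
Proof.
move=> [f fmono _].
have finc (u v : a) : wo_lt u v -> wo_lt (sval (f u)) (sval (f v)).
  by rewrite /wo_lt -(fmono v u).
by have /negP := svalP (f x); apply; exact: (wo_incr_ge finc).
Qed.

(** [same_rank x y] says that the initial segments below [x] and [y] are
    isomorphic, that is, that [x] and [y] have the same ordinal as rank.  It is
    the unique relation matching the elements below [x] with those below [y]. *)
Inductive same_rank (a b : woType) (x : a) (y : b) : Prop := SameRank of
  (forall x', wo_lt x' x -> exists2 y', wo_lt y' y & same_rank x' y') &
  (forall y', wo_lt y' y -> exists2 x', wo_lt x' x & same_rank x' y').

Lemma same_rank_sym (a b : woType) (x : a) (y : b) :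
  same_rank x y -> same_rank y x.
Proof.
elim/wo_ind: x y => x IH y [xy yx]; split.
  by move=> y' /yx[x' x'x s]; exists x' => //; exact: IH.
by move=> x' x'x; have [y' y'y s] := xy _ x'x; exists y' => //; exact: IH.
Qed.

Lemma same_rank_trans (a b c : woType) (x : a) (y : b) (z : c) :
  same_rank x y -> same_rank y z -> same_rank x z.
Proof.
elim/wo_ind: x y z => x IH y z [xy yx] [yz zy]; split.
  move=> x' x'x; have [y' /yz[z' z'z t] s] := xy _ x'x.
  by exists z' => //; exact: IH t.
move=> z' /zy[y' /yx[x' x'x s] t].
by exists x' => //; exact: IH t.
Qed.

Lemma same_rank_fun (a b : woType) (x : a) (y y' : b) :
  same_rank x y -> same_rank x y' -> y = y'.
Proof.
elim/wo_ind: x y y' => x IH y y' [xy yx] [xy' y'x].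
case: (wo_ltgtP y y') => // lt.
- have [x' x'x s] := y'x _ lt; have [z zy t] := xy _ x'x.
  by move: zy; rewrite -(IH _ x'x _ _ s t) /wo_lt wo_refl.
- have [x' x'x s] := yx _ lt; have [z zy t] := xy' _ x'x.
  by move: zy; rewrite -(IH _ x'x _ _ s t) /wo_lt wo_refl.
Qed.

Lemma same_rank_lt (a b : woType) (x x' : a) (y y' : b) :
  same_rank x y -> same_rank x' y' -> wo_lt x x' -> wo_lt y y'.
Proof.
move=> s [xy' _] /xy'[z zy' t].
by rewrite (same_rank_fun s t).
Qed.

Lemma same_rank_wo_le (a b : woType) :
  (forall x : a, exists y : b, same_rank x y) -> wo_le a b.
Proof.
move=> /choice[f fP]; exists f.
  move=> i j; apply/idP/idP; apply: contraLR => lt;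
    last exact: (same_rank_lt (same_rank_sym (fP _)) (same_rank_sym (fP _)) lt).
  exact: (same_rank_lt (fP _) (fP _) lt).
move=> i j jfi; case: (wo_ltgtP j (f i)) => [->|lt|]; first by exists i.
  have [_ /(_ _ lt)[i' _ s]] := fP i.
  by exists i'; exact: (same_rank_fun (fP i') s).
by move=> /negP; rewrite jfi.
Qed.

(** Comparability: if the ranks of [a] do not all occur in [b], then the ranks
    of [b] all occur below one element of [a]. *)
Lemma same_rank_total (a b : woType) :
  wo_le a b \/
  exists x : a, forall y : b, exists2 x', wo_lt x' x & same_rank x' y.
Proof.
have [all_x|/existsNP x0P] := pselect (forall x : a, exists y : b, same_rank x y).
  by left; exact: same_rank_wo_le.
right; have [x nx xmin] := wo_least x0P; exists x => y; apply: contrapT => ny.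
have [|z nz zmin] :=
    @wo_least b (fun y => ~ exists2 x', wo_lt x' x & same_rank x' y).
  by exists y.
(* Everything below [x] has a partner of the same rank, and so has everything
   below [z], there even below [x]; hence [x] and [z] have the same rank. *)
apply: nx; exists z; split=> [x' x'x|z' z'z]; last first.
  by apply: contrapT => /zmin; apply/negP.
have [y' s] : exists y' : b, same_rank x' y'.
  by apply: contrapT => /xmin; apply/negP.
exists y' => //; case: (wo_ltgtP y' z) => // [e|].
  by case: nz; exists x'; rewrite -?e.
move=> zy'; have [_ /(_ _ zy')[x'' x''x' t]] := s.
by case: nz; exists x'' => //; exact: wo_lt_trans x'x.
Qed.

(** If no [b] satisfying [P] has its ranks bounded in [a], then [a] itself is
    least; otherwise a [b] with the least such bound is. *)
Lemma least_ordinal_exists (P : woType -> Prop) (a : woType) :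
  P a -> exists b, least_ordinal P b.
Proof.
move=> Pa.
(* A [b] satisfying [P] whose ranks all occur below [x]. *)
pose below (x : a) :=
  exists2 b, P b & forall y : b, exists2 x', wo_lt x' x & same_rank x' y.
have [ex|nex] := pselect (exists x, below x); last first.
  exists a; split=> // b Pb; case: (same_rank_total a b) => // -[x xP].
  by case: nex; exists x, b.
have [x [b Pb bx] xmin] := wo_least ex.
exists b; split=> // c Pc; case: (same_rank_total b c) => // -[y yP].
have [x' x'x s] := bx y.
have /xmin : below x'.
  exists c => // z; have [y' y'y t] := yP z; have [x'' x''x u] := bx y'.
  exists x''; last exact: same_rank_trans t.
  exact: (same_rank_lt (same_rank_sym u) (same_rank_sym s) y'y).
by move: x'x => /negP.
Qed.

(** * Increasing sequences and the intervals they cut out *)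

Lemma increasing_ge f : increasing f -> forall n, n <= f n.
Proof.
by move=> finc; elim=> // n IH; apply: leq_ltn_trans IH _; apply: finc.
Qed.

Lemma increasing_iterS (g : nat -> nat) :
  (forall x, x < g x) -> increasing (fun n => iter n g 0).
Proof.
by move=> g_gt; apply: homo_ltn => [|i]; [exact: ltn_trans | exact: g_gt].
Qed.

(** The consecutive intervals [[k n, k n.+1)] cover the natural numbers; [I x]
    is the number of the interval that contains [x]. *)
Lemma increasing_index k : increasing k -> k 0 = 0 ->
  exists I : nat -> nat, forall x, k (I x) <= x < k (I x).+1.
Proof.
move=> kinc k0.
suff /choice[I IP] : forall x, exists n, k n <= x < k n.+1 by exists I.
move=> x; have ex : exists n, k n <= x by exists 0; rewrite k0.
have bnd n : k n <= x -> n <= x by exact/leq_trans/increasing_ge.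
have [n kn nmax] := ex_maxnP ex bnd; exists n; rewrite kn ltnNge.
by apply/negP => /nmax; rewrite ltnn.
Qed.

Lemma increasing_lt_inv k : increasing k -> forall m n, k m < k n -> m < n.
Proof.
by move=> /ltnW_homo kle m n; rewrite !ltnNge; apply: contra => /kle.
Qed.

Lemma index_homo k (I : nat -> nat) : increasing k ->
  (forall x, k (I x) <= x < k (I x).+1) -> {homo I : x y / x <= y}.
Proof.
move=> kinc IP x y xy; have /andP[Ix _] := IP x; have /andP[_ Iy] := IP y.
by rewrite -ltnS; apply: (increasing_lt_inv kinc); lia.
Qed.

Lemma index_uniq k (I : nat -> nat) : increasing k ->
  (forall x, k (I x) <= x < k (I x).+1) ->
  forall n x, k n <= x < k n.+1 -> I x = n.
Proof.
move=> kinc IP n x /andP[nx xn]; have /andP[Ix xI] := IP x.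
apply/eqP; rewrite eqn_leq -(ltnS (I x)) -(ltnS n).
by apply/andP; split; apply: (increasing_lt_inv kinc); lia.
Qed.

(** * Ultrafilters that are not coherent to a Q-point *)

(** An ultrafilter contains a class of any finite colouring. *)
Lemma ultra_color (T : Type) (I : finType) (F : set_system T) (col : T -> I) :
  UltraFilter F -> exists i, F [set x | col x = i].
Proof.
move=> FU; apply: contrapT => /forallNP none.
have /filter_forall : forall i, F (~` [set x | col x = i]).
  by move=> i; case: (in_ultra_setVsetC [set x | col x = i] FU) => // /none.
by move=> /filter_ex[x /(_ (col x))]; apply.
Qed.

Lemma ultra_preimage (T U : Type) (f : T -> U) (F : set_system T) :
  UltraFilter F -> UltraFilter [set X : set U | F (f @^-1` X)].
Proof.
move=> FU; split=> [|G GP FG]; first exact: (@fmap_proper_filter _ _ f F).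
apply/seteqP; split=> // X GX /=.
have [//|FC] := in_ultra_setVsetC (f @^-1` X) FU.
have /filter_ex[x []//] : G (X `&` ~` X) by apply: filterI => //; exact: FG.
Qed.

Lemma nonprincipal_set1 (F : set_system nat) n :
  nonprincipal_ultrafilter F -> ~ F [set n].
Proof.
move=> [FU Fn] F1; apply: (Fn n); apply/seteqP; split=> X.
  move=> FX; apply/principal_filterP.
  by have /filter_ex[x [Xx <-]] : F (X `&` [set n]) by exact: filterI.
by move=> /principal_filterP Xn; apply: filterS F1 => x ->.
Qed.

Lemma nonprincipal_ge (F : set_system nat) N :
  nonprincipal_ultrafilter F -> F [set n | N <= n].
Proof.
move=> FP; have [FU _] := FP; elim: N => [|N IH]; first by apply: filterS filterT.
have : F (~` [set N]).
  by case: (in_ultra_setVsetC [set N] FU) => // /(nonprincipal_set1 FP).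
apply: filterS2 IH => n /= Nn nN; rewrite ltn_neqAle Nn andbT.
by apply/eqP => e; apply: nN.
Qed.

Lemma nonprincipal_preimage (f : nat -> nat) (F : set_system nat) :
  (forall n, exists N, forall x, f x = n -> x < N) ->
  nonprincipal_ultrafilter F ->
  nonprincipal_ultrafilter [set X : set nat | F (f @^-1` X)].
Proof.
move=> ffin FP; have [FU _] := FP; split=> [|n e]; first exact: ultra_preimage.
have : principal_filter n [set n] by exact/principal_filterP.
rewrite -e /= => Fn; have [N fN] := ffin n.
have /filter_ex[x [/= /fN]] : F (f @^-1` [set n] `&` [set x | N <= x]).
  by apply: filterI => //; exact: nonprincipal_ge.
by move=> xN /(leq_trans xN); rewrite ltnn.
Qed.

(** This is where the hypothesis on [L] is used.  The image of [L] under the map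
    sending [x] to the left end of its interval is coherent to [L] through [k],
    so it is not a Q-point.  The monotone surjection [phi] witnessing this groups
    the intervals of [k] together, and [p] cuts at the points where [phi]
    changes its value along the intervals: every set of [L] then meets one block
    of [p] in two different intervals of [k]. *)
Lemma not_Q_blocks (L : set_system nat) (k I : nat -> nat) :
  nonprincipal_ultrafilter L ->
  (forall Q : set_system nat, Q_point Q -> ~ coherent L Q) ->
  increasing k -> (forall x, k (I x) <= x < k (I x).+1) ->
  exists p J : nat -> nat,
    [/\ increasing p, forall x, p (J x) <= x < p (J x).+1 &
    forall B, L B -> exists a a', [/\ B a, B a', J a = J a' & I a < I a']].
Proof.
move=> LP LQ kinc IP; have [LU _] := LP.
have kI n : I (k n) = n by apply: (index_uniq kinc IP); rewrite leqnn kinc.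
pose Q := [set X : set nat | L ((k \o I) @^-1` X)].
have QP : nonprincipal_ultrafilter Q.
  apply: nonprincipal_preimage LP => n; exists (k (I n).+1) => x /= <-.
  by rewrite kI; case/andP: (IP x).
have cohLQ : coherent L Q.
  exists k => // X.
  suff -> : Q (\bigcup_(n in X) [set m | k n <= m < k n.+1]) =
            L (\bigcup_(n in X) [set m | k n <= m < k n.+1]) by [].
  congr (L _); apply/seteqP; split=> x [n Xn /= nx]; exists n => //=.
    by rewrite -(index_uniq kinc IP nx) kI.
  by rewrite (index_uniq kinc IP nx) leqnn kinc.
(* A witness that [Q] is not a Q-point. *)
have [phi [phile phisurj phiinj]] : exists phi : nat -> nat,
    [/\ {homo phi : m n / m <= n}, set_surj [set: nat] [set: nat] phi &
        forall A, Q A -> ~ set_inj A phi].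
  apply: contrapT => none; apply: (LQ Q) => //; split=> // phi phile phisurj.
  apply: contrapT => ninj; apply: none; exists phi; split=> // A QA iA.
  by apply: ninj; exists A.
pose H x := phi (k (I x)).
have Hle : {homo H : x y / x <= y}.
  by move=> x y /(index_homo kinc IP) xy; apply/phile/(ltnW_homo kinc).
(* From any [y] one can move on to the first point where [H] exceeds [H y];
   these points start the blocks of [p]. *)
have nextP y : exists z, y < z /\ forall x, x < z -> H x < H z.
  have [v _ vP] := phisurj (H y).+1 Logic.I.
  have ex : exists z, H y < H z.
    exists (k v); rewrite {2}/H kI -vP; apply: phile; exact: increasing_ge.
  have [z yz zmin] := ex_minnP ex; exists z; split.
    by rewrite ltnNge; apply/negP => /Hle; rewrite leqNgt yz.
  move=> x xz; apply: leq_ltn_trans yz; rewrite leqNgt.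
  by apply/negP => /zmin; rewrite leqNgt xz.
have [g gP] := choice nextP.
pose p n := iter n g 0.
have pinc : increasing p by apply: increasing_iterS => x; case: (gP x).
have [J JP] := increasing_index pinc (erefl 0).
exists p, J; split=> // B LB.
have : ~ set_inj [set k (I x) | x in B] phi.
  by apply: phiinj; rewrite /Q /=; apply: filterS LB => x Bx; exists x.
have sameJ a a' : a <= a' -> H a = H a' -> J a = J a'.
  move=> aa' e; apply/esym/(index_uniq pinc JP); have /andP[Ja aJ] := JP a.
  rewrite (leq_trans Ja aa') ltnNge; apply/negP => /Hle.
  by rewrite -e leqNgt; have [_ /(_ _ aJ) ->] := gP (p (J a)).
move=> ninj; apply: contrapT => none; apply: ninj.
move=> _ _ /set_mem[a Ba <-] /set_mem[a' Ba' <-] e.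
have noI x x' : B x -> B x' -> H x = H x' -> ~ I x < I x'.
  move=> Bx Bx' Hx lt; apply: none; exists x, x'; split=> //; apply: sameJ => //.
  by rewrite leqNgt; apply/negP => /ltnW/(index_homo kinc IP); rewrite leqNgt lt.
by case: (ltngtP (I a) (I a')) => [/noI|/noI|-> //]; case.
Qed.

(** * The subgroup of permutations dominated by a family of functions *)

Lemma near_infty_natP (P : nat -> Prop) :
  (\forall n \near \oo, P n) <-> exists N, forall n, N <= n -> P n.
Proof. by split=> [[N _ NP]|[N NP]]; exists N. Qed.

Lemma iter_le_mono (f : nat -> nat) C : {homo f : m n / m <= n} ->
  {homo iter C f : m n / m <= n}.
Proof. by move=> fle m n mn; elim: C => //= C; exact: fle. Qed.

Lemma iter_le_fun (f g : nat -> nat) C : {homo g : m n / m <= n} ->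
  (forall n, f n <= g n) -> forall n, iter C f n <= iter C g n.
Proof.
by move=> gle fg n; elim: C => //= C IH; apply: leq_trans (fg _) (gle _ _ IH).
Qed.

Lemma sym_eventually_ge (s : Sym nat) N : exists M, forall x, M <= x -> N <= s x.
Proof.
exists (\max_(y < N) sym_inv s y).+1 => x; apply: contraTT; rewrite -!ltnNge => sN.
by rewrite ltnS -{1}(sym_funK s x) (leq_bigmax (Ordinal sN)).
Qed.

Lemma le_star_comp (s t : Sym nat) (e : nat -> nat) C D :
  {homo e : m n / m <= n} ->
  le_star s (iter C e) -> le_star t (iter D e) ->
  le_star (fun x => s (t x)) (iter (C + D) e).
Proof.
move=> ele /near_infty_natP[N sN] /near_infty_natP[N' tN].
have [M tM] := sym_eventually_ge t N.
apply/near_infty_natP; exists (maxn M N') => x; rewrite geq_max => /andP[Mx Nx].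
apply: leq_trans (sN _ (tM _ Mx)) _; rewrite iterD.
by apply: iter_le_mono => //; exact: tN.
Qed.

(** The permutations that, together with their inverse, are eventually bounded
    by an iterate of one nondecreasing function of [K].  Functions of [K] are
    only required to be nondecreasing, not strictly increasing, so that
    the family of all functions below a given one, which may be constant,
    provides at least the identity. *)
Definition dominated_perms (K : set (nat -> nat)) : set (Sym nat) :=
  [set s : Sym nat | exists2 f, {homo f : m n / m <= n} /\ K f &
     exists C, le_star s (iter C f) /\ le_star s^-1%g (iter C f)].

Lemma dominated_perms_subgroup (K : set (nat -> nat)) :
  (exists2 f, {homo f : m n / m <= n} & K f) ->
  (forall f g, K f -> K g -> K (fun n => maxn (f n) (g n))) ->
  subgroup (dominated_perms K).
Proof.
move=> [f0 f0le Kf0] Kmax; split.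
  apply/mem_set; exists f0 => //; exists 0.
  by split; apply/near_infty_natP; exists 0.
move=> s t /set_mem[f [fle Kf] [C [sC sVC]]] /set_mem[g [gle Kg] [D [tD tVD]]].
apply/mem_set; pose e n := maxn (f n) (g n).
have ele : {homo e : m n / m <= n}.
  by move=> m n mn; rewrite /e; have := fle _ _ mn; have := gle _ _ mn; lia.
have le_e (h x : nat -> nat) E : (forall n, h n <= e n) ->
    le_star x (iter E h) -> le_star x (iter E e).
  move=> he /near_infty_natP[N xN]; apply/near_infty_natP; exists N => n Nn.
  by apply: leq_trans (xN _ Nn) _; exact: iter_le_fun.
have fe n : f n <= e n by exact: leq_maxl.
have ge n : g n <= e n by exact: leq_maxr.
exists e; first by split=> //; exact: Kmax.
exists (C + D); split.
  exact: (@le_star_comp s t^-1%g _ _ _ ele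
            (le_e _ _ _ fe sC) (le_e _ _ _ ge tVD)).
rewrite addnC.
have -> : (((s / t)^-1)%g : nat -> nat) = (fun x => t (s^-1 x)%g).
  by apply/funext.
exact: (@le_star_comp t s^-1%g _ _ _ ele
          (le_e _ _ _ ge tD) (le_e _ _ _ fe sVC)).
Qed.

Lemma S_sub_dominated_perms (K : set (nat -> nat)) f :
  (forall f g, K f -> K g -> K (fun n => maxn (f n) (g n))) ->
  {homo f : m n / m <= n} -> K f -> S_ f `<=` dominated_perms K.
Proof.
move=> Kmax fle Kf; apply: smallest_sub; last first.
  by move=> s sf; exists f => //; exists 1.
by apply: dominated_perms_subgroup => //; exists f.
Qed.

(** * Permutations that move a sequence forward *)

Section Extension.
Variables (p : nat -> nat) (pinj : injective p).

(** [t] transported to the range of [p], and the identity elsewhere. *)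
Definition extend_along (t : nat -> nat) (x : nat) : nat :=
  if pselect (exists j, p j = x) is left e then p (t (projT1 (cid e))) else x.

Lemma extend_alongE t j : extend_along t (p j) = p (t j).
Proof.
rewrite /extend_along; case: pselect => [e|[]]; last by exists j.
by case: cid => i /= /pinj ->.
Qed.

Lemma extend_along_id t x : (forall j, p j <> x) -> extend_along t x = x.
Proof. by rewrite /extend_along; case: pselect => // -[j pj] /(_ j)/(_ pj). Qed.

Lemma extend_alongK t u : cancel t u -> cancel (extend_along t) (extend_along u).
Proof.
move=> tK x; have [[j <-]|np] := pselect (exists j, p j = x).
  by rewrite !extend_alongE tK.
by rewrite !extend_along_id // => j pj; apply: np; exists j.
Qed.

Definition sym_extend (s : Sym nat) : Sym nat :=
  SymBuild (extend_alongK (sym_funK s)) (extend_alongK (sym_invK s)).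

End Extension.

(** The permutation ... -> 4 -> 2 -> 0 -> 1 -> 3 -> 5 -> ... with a single
    infinite cycle: either it or its inverse sends [j] to [j.+2]. *)
Definition shuttle (j : nat) : nat :=
  if odd j then j.+2 else if j is 0 then 1 else j.-2.
Definition shuttle_inv (j : nat) : nat :=
  if odd j then (if j is 1 then 0 else j.-2) else j.+2.

Lemma shuttleK : cancel shuttle shuttle_inv.
Proof.
move=> [|[|j]]; rewrite /shuttle /shuttle_inv //= negbK.
by case o: (odd j); rewrite /= ?negbK ?o.
Qed.

Lemma shuttle_invK : cancel shuttle_inv shuttle.
Proof.
move=> [|[|j]]; rewrite /shuttle /shuttle_inv //= negbK.
by case o: (odd j); rewrite /= ?negbK ?o.
Qed.

Lemma exists_leaping_perm (p : nat -> nat) : injective p ->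
  exists s : Sym nat, forall j, s (p j) = p j.+2 \/ s^-1%g (p j) = p j.+2.
Proof.
move=> pinj; exists (sym_extend pinj (SymBuild shuttleK shuttle_invK)) => j.
rewrite /= !(extend_alongE pinj) /= /shuttle /shuttle_inv.
by case: (odd j); [left|right].
Qed.

(** * Families bounded modulo the ultrafilter *)

Lemma exists_slow_partition (h : nat -> nat) : exists k : nat -> nat,
  [/\ increasing k, k 0 = 0 & forall n x, x < k n -> h x <= k n.+1].
Proof.
pose g y := (y + \sum_(x < y) h x).+1.
exists (fun n => iter n g 0); split=> //.
  by apply: increasing_iterS => x; rewrite /g ltnS leq_addr.
move=> n x xn /=; rewrite /g (bigD1 (Ordinal xn)) //=; lia.
Qed.

(** Choose [k] growing faster than [h], and a permutation [s] such that [s] or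
    its inverse moves the start of each block of [p] beyond the end of that
    block.  If an iterate [f^C] bounded
    [s] and its inverse, the orbit of the start of a block under [f] would leave
    the block in at most [C] steps.  Colour a point by the number of steps
    needed to pass it and by the parity of its [k]-interval.  Points [a < a'] of
    one block and one colour satisfy [a' < f a], hence [a' < h a] when
    [f a <= h a], so they lie in the same or in adjacent intervals, and by parity
    in the same one.  This contradicts the choice of [p]. *)
Lemma dominated_perms_proper (L : set_system nat) (h : nat -> nat)
    (K : set (nat -> nat)) :
  nonprincipal_ultrafilter L ->
  (forall Q : set_system nat, Q_point Q -> ~ coherent L Q) ->
  (forall f, K f -> le_filter L f h) -> dominated_perms K <> [set: Sym nat].
Proof.
move=> LP LQ Kh allS; have [LU _] := LP.
have [k [kinc k0 kh]] := exists_slow_partition h.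
have [I IP] := increasing_index kinc k0.
have [p [J [pinc JP LB]]] := not_Q_blocks LP LQ kinc IP.
have [s sp] := exists_leaping_perm (incn_inj (leq_mono pinc)).
have [f [fle Kf] [C []]] : dominated_perms K s by rewrite allS.
move=> /near_infty_natP[N sN] /near_infty_natP[N' sVN].
pose M := maxn N N'.
have leap j : M <= p j -> p j.+2 <= iter C f (p j).
  rewrite geq_max => /andP[Nj N'j].
  by case: (sp j) => <-; [exact: sN | exact: sVN].
(* [level a c]: after [c] steps from the start of its block, [f] has passed
   [a]. *)
pose level a (c : 'I_C.+1) := a < iter c f (p (J a)).
pose col a := ([arg min_(c < ord_max | level a c) c], odd (I a)).
have [[c o] Lco] := ultra_color col LU.
have [] := LB ([set a | col a = (c, o)] `&` [set a | f a <= h a]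
                 `&` [set a | p M <= a]).
  by do 2?[apply: filterI => //]; [exact: Kh | exact: nonprincipal_ge].
move=> a [a' [[[/= ca fa] Ma] [[/= ca' _] Ma'] Jaa' Iaa']].
have levelmax b : p M <= b -> level b ord_max.
  move=> Mb; have /andP[_ bJ] := JP b.
  have MJ : M <= J b by rewrite -ltnS; apply: (increasing_lt_inv pinc); lia.
  have Mp : M <= p (J b) by apply: leq_trans MJ _; exact: increasing_ge.
  have := leap _ Mp; have := pinc _ _ (ltnSn (J b).+1); rewrite /level /=; lia.
have cP b : p M <= b -> col b = (c, o) ->
    level b c /\ forall d : 'I_C.+1, level b d -> c <= d.
  by move=> Mb [<- _]; case: arg_minnP => //; exact: levelmax.
have odd_eq : odd (I a) = odd (I a') by case: ca => _ ->; case: ca' => _ ->.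
have [ac cmin] := cP a Ma ca; have [a'c _] := cP a' Ma' ca'.
(* The level is positive, because a block contains no point before its
   start. *)
case: c cmin ac a'c {ca ca' Lco cP} => -[|d] dC cmin;
  rewrite /level /= -Jaa' => ac a'c.
  by have /andP[] := JP a; lia.
have da : iter d f (p (J a)) <= a.
  rewrite leqNgt; apply/negP => lt.
  by have /= := cmin (Ordinal (ltnW dC)) lt; rewrite ltnn.
have a'ha : a' < h a.
  by apply: leq_trans a'c (leq_trans _ fa); exact: fle.
have hka : h a <= k (I a).+2 by apply: kh; case/andP: (IP a).
have : I a' < (I a).+2.
  by apply: (increasing_lt_inv kinc); have /andP[] := IP a'; lia.
lia.
Qed.

(** * Cofinality and the chain of subgroups *)

Lemma cofinality_exists (T : eqType) (R : T -> T -> Prop) :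
  (forall x, R x x) -> exists kap, is_cofinality R kap.
Proof.
move=> Rxx; have [W WP] := well_ordering_principle T.
apply: (@least_ordinal_exists _ (WoType WP)); exists [set: T]; split.
  by move=> x; exists x.
exact: card_eqxx.
Qed.

(** A cofinal set can be enumerated along the cofinality in such a way that no
    proper initial segment of the enumeration is cofinal: such a segment would
    be indexed by a shorter well-order. *)
Lemma cofinality_enum (T : Type) (R : T -> T -> Prop) kap :
  is_cofinality R kap ->
  exists d : kap -> T, (forall x, exists i, R x (d i)) /\
    forall i, ~ (forall x, exists2 j, wo_lt j i & R x (d j)).
Proof.
move=> [[D [Dcof /card_esym/card_bijP[f fbij]]] kmin].
pose d i := sval (f (exist _ i (mem_set Logic.I))).
have dinj : injective d.
  move=> i j /val_inj/(bij_inj fbij) e.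
  by have := congr1 val e.
have dD x : D x -> exists i, d i = x.
  move=> Dx; have [g _ gK] := fbij.
  have := congr1 sval (gK (exist _ x (mem_set Dx))).
  case: (g _) => i iT /= <-; exists i; rewrite /d.
  by congr (sval (f (exist _ _ _))); exact: bool_irrelevance.
exists d; split=> [x|i icof].
  by have [y /dD[i <-] xy] := Dcof x; exists i.
apply: (@wo_le_segF kap i); apply: kmin.
exists [set d (sval u) | u in [set: wo_seg i]]; split.
  move=> x; have [j ji xj] := icof x.
  by exists (d j) => //; exists (exist _ j ji).
apply: inj_card_eq => u v _ _ /dinj; exact: val_inj.
Qed.

Lemma le_filter_refl (F : set_system nat) x : Filter F -> le_filter F x x.
Proof. by move=> FF; apply: filterS filterT => n /=. Qed.

Lemma le_filter_trans (F : set_system nat) y x z : Filter F ->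
  le_filter F x y -> le_filter F y z -> le_filter F x z.
Proof. by move=> FF; apply: filterS2 => n /=; exact: leq_trans. Qed.

Lemma le_filter_total (F : set_system nat) x y : UltraFilter F ->
  le_filter F x y \/ le_filter F y x.
Proof.
move=> FU; have [|Fn] := in_ultra_setVsetC [set n | x n <= y n] FU; first by left.
by right; apply: filterS Fn => n /= /negP; rewrite -ltnNge => /ltnW.
Qed.

Lemma le_filter_max (F : set_system nat) f g h : Filter F ->
  le_filter F f h -> le_filter F g h ->
  le_filter F (fun n => maxn (f n) (g n)) h.
Proof. by move=> FF; apply: filterS2 => n /=; rewrite geq_max => -> ->. Qed.

Lemma exists_increasing_ge (h : nat -> nat) :
  exists2 f, increasing f & forall n, h n <= f n.
Proof.
exists (fun n => n + \sum_(i < n.+1) h i).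
  apply: homo_ltn => [|n]; first exact: ltn_trans.
  by rewrite [X in _ < _ + X]big_ord_recr /=; lia.
by move=> n; rewrite big_ord_recr /=; lia.
Qed.

(** The chain takes at [i] the permutations dominated by the functions that lie
    below a member of index at most [i] in a cofinal enumeration. *)
Lemma cfstar_chain_exists (L : set_system nat) (kap : woType) :
  nonprincipal_ultrafilter L ->
  (forall Q : set_system nat, Q_point Q -> ~ coherent L Q) ->
  is_b L kap -> exists G : kap -> set (Sym nat), cfstar_chain G.
Proof.
move=> LP LQ /cofinality_enum[d [dcof dseg]]; have [LU _] := LP.
pose K i : set (nat -> nat) :=
  [set f | exists2 j, wo_rel j i & le_filter L f (d j)].
have Kmax i f g : K i f -> K i g -> K i (fun n => maxn (f n) (g n)).
  move=> [j ji fj] [j' j'i gj'].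
  have [jj'|j'j] := le_filter_total (d j) (d j') LU.
    by exists j' => //; apply: le_filter_max => //; exact: le_filter_trans jj'.
  by exists j => //; apply: le_filter_max => //; exact: le_filter_trans j'j.
(* The enumeration below [i] is not cofinal, so by totality it has an upper
   bound [h]; including [d i] itself only requires a maximum. *)
have Kbound i : exists h, forall f, K i f -> le_filter L f h.
  have /existsNP[h hP] := dseg i.
  exists (fun n => maxn (h n) (d i n)) => f [j ji fj].
  have : le_filter L (d j) (fun n => maxn (h n) (d i n)); last first.
    exact: le_filter_trans fj.
  have [->|lt|] := wo_ltgtP j i.
  - by apply: filterS filterT => n _ /=; exact: leq_maxr.
  - have [jh|hj] := le_filter_total (d j) h LU; last by case: hP; exists j.
    by apply: filterS jh => n /= /leq_trans; apply; exact: leq_maxl.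
  - by rewrite /wo_lt ji.
have K0 i : K i (fun=> 0).
  by exists i; [exact: wo_refl | apply: filterS filterT => n _].
have Kcof f : exists i, K i f.
  by have [i fi] := dcof f; exists i, i => //; exact: wo_refl.
exists (fun i => dominated_perms (K i)); split.
- move=> i; split.
    by apply: dominated_perms_subgroup; [exists (fun=> 0) | exact: Kmax].
  have [h Kh] := Kbound i; exact: dominated_perms_proper LP LQ Kh.
- move=> i j ij s [f [fle [l li fl]] sf]; exists f => //; split=> //.
  by exists l => //; exact: wo_trans ij.
- apply/seteqP; split=> // s _.
  have [f finc sf] := exists_increasing_ge (fun n => maxn (s n) (s^-1%g n)).
  have [i Kif] := Kcof f; exists i => //; exists f.
    by split=> //; exact: ltnW_homo.
  by exists 1; split; apply/near_infty_natP; exists 0 => n _;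
    apply: leq_trans (sf n); rewrite ?leq_maxl ?leq_maxr.
- move=> f finc; have [i Kif] := Kcof f; exists i.
  by apply: S_sub_dominated_perms => //; [exact: Kmax | exact: ltnW_homo].
Qed.

Theorem corollary1p6 (L : set_system nat)
  (hL : nonprincipal_ultrafilter L)
  (hLQ : forall Q : set_system nat, Q_point Q -> ~ coherent L Q) :
  exists lam kap : woType,
    [/\ is_cfstar lam, is_b L kap & wo_le lam kap].
Proof.
have [LU _] := hL.
have [kap kapP] : exists kap, is_b L kap.
  by apply: cofinality_exists => x; exact: le_filter_refl.
have chain := cfstar_chain_exists hL hLQ kapP.
have [lam lamP] : exists lam, is_cfstar lam.
  exact: (@least_ordinal_exists
            (fun lam => exists G : lam -> set (Sym nat), cfstar_chain G) kap).
by exists lam, kap; split=> //; case: lamP => _; apply.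
Qed.
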